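(* Let $T_1,T_2\in\mathcal{B}(\mathcal{H})$ be any contractions and let $Q\in\mathcal{B}(\mathcal{H})$ be such that $QT_2$ is a contraction and $T_1T_2=QT_2T_1$. Then there is a Hilbert space $\mathcal{K}$ containing $\mathcal{H}$, a bounded linear operator $\overline{Q}=Q\oplus Q'$ on $\mathcal{K}=\mathcal{H}\oplus(\mathcal{K}\ominus\mathcal{H})$ (for some bounded operator $Q'$ on $\mathcal{K}\ominus\mathcal{H}$), and operators $V_1,V_2,V_{2Q}\in\mathcal{B}(\mathcal{K})$ such that $V_1$, $V_2$, $\overline{Q}V_{2Q}$ are isometric lifts of $T_1$, $T_2$, $QT_2$ respectively and $V_1V_2=\overline{Q}V_{2Q}V_1$.
   Context: All Hilbert spaces are complex; $\mathcal{B}(\mathcal{H})$ is the algebra of bounded linear operators on $\mathcal{H}$; containment of Hilbert spaces means containment as a closed linear subspace; a contraction is an operator of norm at most one. An operator $B\in\mathcal{B}(\mathcal{K})$ is a lift of $A\in\mathcal{B}(\mathcal{H})$, $\mathcal{H}\subseteq\mathcal{K}$, if $\mathcal{H}$ is invariant under $B^*$ and $B^*|_{\mathcal{H}}=A^*$; it is an isometric lift if in addition $B$ is an isometry. *)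

(* Defs.v *)
From HB Require Import structures.
From mathcomp Require Import all_boot all_order all_algebra sesquilinear.
From mathcomp Require Import all_classical all_reals all_analysis.
From mathcomp Require Import complex.

Set Implicit Arguments.
Unset Strict Implicit.
Unset Printing Implicit Defensive.

Import Order.TTheory GRing.Theory Num.Theory Num.Def.
Import numFieldNormedType.Exports.

Local Open Scope classical_set_scope.
Local Open Scope ring_scope.

(* The inner product is linear in its first argument. *)
HB.mixin Record CompleteNormedModule_isHilbert (R : realType) H
    & CompleteNormedModule R[i] H := {
  hdot : {dot H for conjC} ;
  sqr_normr_hdot : forall x : H, `|x| ^+ 2 = hdot x x
}.

#[short(type="hilbertType")]
HB.structure Definition Hilbert (R : realType) :=
  {H of CompleteNormedModule R[i] H & CompleteNormedModule_isHilbert R H}.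

(* `M` is automatically a nonnegative real number unless U is trivial, because
   z <= w in R[i] holds only if w - z is a nonnegative real. *)
HB.mixin Record isBoundedOperator (R : realType) (U V : normedModType R[i])
    (f : U -> V) := {
  bounded_operator : exists M : R[i], forall x, `|f x| <= M * `|x|
}.

#[short(type="boundedOperator")]
HB.structure Definition BoundedOperator (R : realType)
    (U V : normedModType R[i]) :=
  {f of @GRing.Linear R[i] U V *:%R f & isBoundedOperator R U V f}.

Notation "''B' ( H )" := (boundedOperator H H)
  (at level 8, format "''B' ( H )") : type_scope.

Lemma bounded_operator_pos (R : realType) (U V : normedModType R[i])
    (f : boundedOperator U V) :
  exists2 M : R[i], 0 <= M & forall x, `|f x| <= M * `|x|.
Proof.
have [M Mf] := @bounded_operator _ _ _ f.
have [[x x0]|] := pselect (exists x : U, x != 0).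
  exists M => //; rewrite -(@pmulr_lge0 _ `|x|) ?normr_gt0//.
  exact: le_trans (normr_ge0 _) (Mf x).
move=> /forallNP U0; exists 0 => // x; have [->|/U0//] := eqVneq x 0.
by rewrite linear0 !normr0 mulr0.
Qed.

Section comp_bounded_operator.
Context (R : realType) (U V W : normedModType R[i]).
Context (g : boundedOperator V W) (f : boundedOperator U V).

Let comp_bounded : exists M : R[i], forall x, `|(g \o f) x| <= M * `|x|.
Proof.
have [M M0 gM] := bounded_operator_pos g; have [N fN] := @bounded_operator _ _ _ f.
by exists (M * N) => x /=; rewrite (le_trans (gM _))// -mulrA ler_wpM2l.
Qed.

HB.instance Definition _ := isBoundedOperator.Build R U W (g \o f) comp_bounded.

End comp_bounded_operator.

(* Norms of vectors are complex numbers that happen to be real and nonnegative;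
   the operator norm is taken in R in order to use the library's supremum. *)
Definition opnorm (R : realType) (U V : normedModType R[i]) (f : U -> V) : R :=
  sup [set complex.Re `|f x| | x in [set x : U | `|x| <= 1]].

Definition contractive_op (R : realType) (U V : normedModType R[i])
  (A : boundedOperator U V) : Prop := opnorm A <= 1.

Lemma contractive_opP (R : realType) (U V : normedModType R[i])
    (A : boundedOperator U V) :
  contractive_op A <-> forall x, `|A x| <= `|x|.
Proof.
have Re_le (z w : R[i]) : 0 <= z -> 0 <= w -> (complex.Re z <= complex.Re w) = (z <= w).
  by rewrite !lecE => /andP[/eqP-> _] /andP[/eqP-> _]; rewrite eqxx.
have [M M0 AM] := bounded_operator_pos A.
set S := [set complex.Re `|A x| | x in [set x : U | `|x| <= 1]].
have S0 : S !=set0 by exists (complex.Re `|A 0|), 0 => //=; rewrite normr0.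
split=> [A1 x|A1]; last first.
  apply: ge_sup => // _ [x /= x1 <-]; rewrite -[leRHS]/(complex.Re (1 : R[i])).
  by rewrite Re_le// (le_trans (A1 x)).
have [->|x0] := eqVneq x 0; first by rewrite linear0 !normr0.
have nx0 : 0 < `|x| by rewrite normr_gt0.
have : complex.Re `|A (`|x|^-1 *: x)| <= complex.Re (1 : R[i]).
  apply: le_trans A1; apply: ub_le_sup; last first.
    by exists (`|x|^-1 *: x) => //=; rewrite normrZ normfV normr_id mulVf ?gt_eqF.
  exists (complex.Re M) => _ [y /= y1 <-]; rewrite Re_le// (le_trans (AM y))//.
  by rewrite ler_piMr.
rewrite Re_le// linearZ /= normrZ normfV normr_id mulrC ler_pdivrMr//.
by rewrite mul1r.
Qed.

Definition isometric (R : realType) (U V : normedModType R[i]) (f : U -> V) :=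
  forall x, `|f x| = `|x|.

Section CauchySchwarz.
Context (R : realType) (H : hilbertType R).

Lemma hdot_CauchySchwarz (x y : H) : `|hdot x y| <= `|x| * `|y|.
Proof.
have [->|y0] := eqVneq y 0; first by rewrite linear0r !normr0 mulr0.
have n0 : 0 < hdot y y by rewrite dnorm_gt0.
have nR : (hdot y y)^* = hdot y y by apply/CrealP/ger0_real/ltW.
have cE : conjC (hdot x y / hdot y y) * hdot x y = `|hdot x y| ^+ 2 / hdot y y.
  by rewrite rmorphM fmorphV /= nR mulrAC [_ * hdot x y]mulrC -normCK.
have cR : conjC (`|hdot x y| ^+ 2 / hdot y y) = `|hdot x y| ^+ 2 / hdot y y.
  by apply/CrealP/ger0_real; rewrite divr_ge0 ?exprn_ge0// ltW.
have := dnorm_ge0 hdot (x - (hdot x y / hdot y y) *: y).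
rewrite dnormB dnormZ linearZr_LR /= cE cR.
rewrite normrM normfV (ger0_norm (ltW n0)) expr_div_n [X in _ / X]expr2.
rewrite invfM mulrA mulfVK ?gt_eqF// opprD addrA addrK subr_ge0.
rewrite ler_pdivrMr// -!sqr_normr_hdot -exprMn.
by rewrite ler_sqr ?nnegrE ?mulr_ge0.
Qed.

End CauchySchwarz.

(* ocompl J is the orthogonal complement of the range of J, as a Hilbert space
   with the inner product of K. *)
Section ocompl.
Context (R : realType) (H K : hilbertType R) (J : H -> K).

Definition ocompl_pred : {pred K} :=
  [pred k | `[< forall h : H, hdot (J h) k = 0 >]].

Lemma ocompl_predP k :
  reflect (forall h : H, hdot (J h) k = 0) (k \in ocompl_pred).
Proof. exact: asboolP. Qed.

Lemma ocompl_submod_closed : submod_closed ocompl_pred.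
Proof.
split=> [|a u v /ocompl_predP u0 /ocompl_predP v0].
  by apply/ocompl_predP => h; rewrite linear0r.
by apply/ocompl_predP => h; rewrite linearDr linearZr_LR /= u0 v0 mulr0 addr0.
Qed.

HB.instance Definition _ :=
  GRing.isSubmodClosed.Build R[i] K ocompl_pred ocompl_submod_closed.

Record ocompl := OCompl { ocompl_val : K ; _ : ocompl_val \in ocompl_pred }.

HB.instance Definition _ := [isSub for ocompl_val].
HB.instance Definition _ := [Choice of ocompl by <:].
HB.instance Definition _ := [SubChoice_isSubLmodule of ocompl by <:].

Let norm (k : ocompl) : R[i] := `|\val k|.

Let ler_norm x y : norm (x + y) <= norm x + norm y.
Proof. exact: ler_normD. Qed.

Let norm_Z l x : norm (l *: x) = `|l| * norm x.
Proof. exact: normrZ. Qed.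

Let norm_0 x : norm x = 0 -> x = 0.
Proof. by move=> /normr0_eq0 x0; apply: val_inj. Qed.

HB.instance Definition _ :=
  Lmodule_isNormed.Build R[i] ocompl ler_norm norm_Z norm_0.

Lemma ocompl_normE (x : ocompl) : `|x| = `|\val x|.
Proof. by []. Qed.

Let cvg_ocompl (F : set_system ocompl) : ProperFilter F -> cauchy F -> cvg F.
Proof.
move=> PF /cauchy_ballP Fc; set G := \val @ F.
have GF : ProperFilter G by apply: fmap_proper_filter.
have /cauchy_cvg/cvg_ex[l Gl] : cauchy G.
  apply/cauchy_ballP => e e0; have := Fc e e0.
  case=> -[A B] /= [FA FB] AB.
  exists (\val @` A, \val @` B) => /=.
    by split; [apply: filterS FA|apply: filterS FB] => u uA; exists u.
  move=> [_ _] /= [[u Au <-] [v Bv <-]].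
  by have := AB (u, v) (conj Au Bv); rewrite -!ball_normE.
have Gdist e : 0 < e -> \forall t \near F, `|l - \val t| < e.
  by move=> e0; move/cvgrPdist_lt : Gl => /(_ e e0).
have lJ : l \in ocompl_pred.
  apply/ocompl_predP => h; apply/eqP; rewrite -normr_le0.
  apply/ler_addgt0Pr => e e0; rewrite add0r.
  have e1 : 0 < e / (`|J h| + 1) by rewrite divr_gt0// ltr_wpDl.
  have [t lt] := filter_ex (Gdist _ e1).
  have /ocompl_predP t0 := valP t.
  rewrite -[hdot _ _]subr0 -(t0 h) -linearBr (le_trans (hdot_CauchySchwarz _ _))//.
  rewrite (le_trans (ler_wpM2l _ (ltW lt)))// mulrCA ler_piMr ?(ltW e0)//.
  by rewrite ler_pdivrMr ?ltr_wpDl// mul1r lerDl.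
by apply/cvg_ex; exists (OCompl lJ); apply/cvgrPdist_lt => e /Gdist.
Qed.

HB.instance Definition _ := Uniform_isComplete.Build ocompl cvg_ocompl.

Definition ocompl_dot (x y : ocompl) : R[i] := hdot (\val x) (\val y).

Let ocompl_dot_bilinear : bilinear_for *%R (conjC \; *%R) ocompl_dot.
Proof.
split=> [u'|u] a x y; rewrite /ocompl_dot /=.
  by rewrite linearDl linearZl_LR.
by rewrite linearDr linearZr_LR.
Qed.

HB.instance Definition _ := bilinear_isBilinear.Build R[i] ocompl ocompl R[i]
  *%R (conjC \; *%R) ocompl_dot ocompl_dot_bilinear.

Let ocompl_dot_herm (x y : ocompl) :
  ocompl_dot x y = (-1) ^+ false * conjC (ocompl_dot y x).
Proof. exact: hermC. Qed.

HB.instance Definition _ := isHermitianSesquilinear.Build R[i] ocompl false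
  conjC ocompl_dot ocompl_dot_herm.

Let ocompl_dot_gt0 (x : ocompl) : x != 0 -> 0 < ocompl_dot x x.
Proof. by move=> x0; apply: neq0_dnorm_gt0. Qed.

HB.instance Definition _ :=
  isDotProduct.Build R[i] ocompl ocompl_dot ocompl_dot_gt0.

Let ocompl_sqr_normr (x : ocompl) : `|x| ^+ 2 = ocompl_dot x x.
Proof. exact: sqr_normr_hdot. Qed.

HB.instance Definition _ := CompleteNormedModule_isHilbert.Build R ocompl
  ocompl_sqr_normr.

End ocompl.

Definition is_adjoint (R : realType) (H : hilbertType R) (A A' : 'B(H)) : Prop :=
  forall x y, hdot (A x) y = hdot x (A' y).

(* H is regarded as a subspace of K along a linear map J : H -> K preserving
   inner products (sesquilinear.isometry); its range is closed because H is
   complete. Invariance of H under the adjoint of B, and the equality of its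
   restriction to H with the adjoint of A, are both part of the last equation. *)
Definition is_lift (R : realType) (H K : hilbertType R) (J : H -> K)
    (A : 'B(H)) (B : 'B(K)) : Prop :=
  exists (A' : 'B(H)) (B' : 'B(K)),
    [/\ is_adjoint A A', is_adjoint B B' & forall h, B' (J h) = J (A' h)].

Definition isometric_lift (R : realType) (H K : hilbertType R) (J : H -> K)
    (A : 'B(H)) (B : 'B(K)) : Prop :=
  is_lift J A B /\ isometric B.

Definition is_direct_sum (R : realType) (H K : hilbertType R) (J : H -> K)
    (A : 'B(H)) (A' : 'B(ocompl J)) (B : 'B(K)) : Prop :=
  forall (h : H) (k : ocompl J), B (J h + \val k) = J (A h) + \val (A' k).

(* Main.v *)
Require Import Defs.
From HB Require Import structures.
From mathcomp Require Import all_boot all_order all_algebra sesquilinear.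
From mathcomp Require Import all_classical all_reals all_analysis.
From mathcomp Require Import complex.
From mathcomp Require Import ring.

Set Implicit Arguments.
Unset Strict Implicit.
Unset Printing Implicit Defensive.

Import Order.TTheory GRing.Theory Num.Theory Num.Def.
Import numFieldNormedType.Exports.

Local Open Scope classical_set_scope.
Local Open Scope ring_scope.

(** The operator [Q T2] is itself a contraction [S] with [T1 T2 = S T1], and [Q]
re-enters only at the very end: given isometric lifts [V1], [V2], [W] of [T1],
[T2], [S] with [V1 V2 = W V1], take [Qbar] to be [Q] on [H] and the identity on
the orthogonal complement, and let [V2Q] be [W] with its component in [H]
changed from [S] to [T2] ([intertwined_lifts_direct_sum]). So the point is to
lift the relation [T1 T2 = S T1] to isometries on a common space.

A contraction [T] on [H] with an operator [D] into [l2 H] such that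
[|D h|^2 = |h|^2 - |T h|^2] has the isometric lift
[(h, t) |-> (T h, mix (D h) t)] on [l2 H], viewed as the sum of [H] (the zeroth
coordinate) and [l2 H] (the others); [mix] interleaves two sequences and makes
room for [D h] ([isometric_lift_exists]). The operator [D] is obtained without
square roots: for the alternating iterates [y_0 = h, y_1 = T h, y_2 = T' T h,
...] of [T] and its adjoint [T'], the inner product of [y_n] and [y_(n+2)] is
[|y_(n+1)|^2], so [sum_n |y_n - y_(n+2)|^2] telescopes to [|h|^2 - |T h|^2],
because the decreasing sequence [|y_n|^2] converges ([defect_exists]).

Take such lifts [V1], [V2], [W0] of [T1], [T2], [S] on [l2 H]. The vectors
[W0 V1 x] and [V1 V2 x] have the same norm and the same component
[S T1 x_0 = T1 T2 x_0] in [H], so their other components have equal norms and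
the former are carried to the latter by a contraction ([contractive_factor]).
Correcting [W0] by it gives a contraction [C] that lifts [S] and satisfies
[C V1 = V1 V2] ([contractive_intertwiner]).

Finally let [W] be the isometric lift of [C] to the sequences over [l2 H], and
extend [V1] by the identity and [V2] by [t |-> mix 0 t]. As [C] is isometric on
the range of [V1], its defect [D_C] vanishes there, so that
[W V1 (x, t) = (C V1 x, mix (D_C (V1 x)) t) = (V1 V2 x, mix 0 t) = V1 V2 (x, t)].

What remains is Hilbert space theory: the space [l2 H], and one variational
form of the Riesz theorem ([riesz_closure]), which yields both the adjoints and
the contractive factor. *)

(** * The norm of an inner product *)

Section DotNorm.
Context (C : numClosedFieldType) (U : lmodType C) (dot : {dot U for conjC}).

Lemma add_conjC_le (z : C) : z + z^* <= 2 * `|z|.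
Proof.
have : 'Re z <= `|z| by apply: leif_Re_Creal.
by rewrite ReE ler_pdivrMr ?ltr0n// mulrC.
Qed.

Lemma dotDl (x y z : U) : dot (x + y) z = dot x z + dot y z.
Proof. exact: linearDl. Qed.

Lemma dotDr (x y z : U) : dot z (x + y) = dot z x + dot z y.
Proof. exact: linearDr. Qed.

Lemma dotBr (x y z : U) : dot z (x - y) = dot z x - dot z y.
Proof. exact: linearBr. Qed.

Lemma dotZl a (x y : U) : dot (a *: x) y = a * dot x y.
Proof. exact: linearZl_LR. Qed.

Lemma dotZr a (x y : U) : dot x (a *: y) = a^* * dot x y.
Proof. exact: linearZr_LR. Qed.

Lemma dot_conjC (x y : U) : (dot x y)^* = dot y x.
Proof. by rewrite [RHS]hermC expr0 mul1r. Qed.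

Lemma dot_CauchySchwarz (x y : U) : `|dot x y| ^+ 2 <= dot x x * dot y y.
Proof.
have [->|y0] := eqVneq y 0; first by rewrite !linear0r normr0 expr0n.
have n0 : 0 < dot y y by rewrite dnorm_gt0.
have := dnorm_ge0 dot (dot y y *: x - dot x y *: y).
rewrite dnormB !dnormZ dotZl dotZr !rmorphM /= conjCK !dot_conjC.
rewrite (ger0_norm (ltW n0)) normCK dot_conjC.
have -> : dot y y ^+ 2 * dot x x + dot x y * dot y x * dot y y -
   (dot y y * (dot y x * dot x y) + dot y y * (dot x y * dot y x)) =
   dot y y * (dot x x * dot y y - dot x y * dot y x) by ring.
by rewrite pmulr_rge0// subr_ge0.
Qed.

Lemma dot_norm_triangle (x y : U) :
  sqrtC (dot (x + y) (x + y)) <= sqrtC (dot x x) + sqrtC (dot y y).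
Proof.
have xy0 := addr_ge0 (sqrt_dnorm_ge0 dot x) (sqrt_dnorm_ge0 dot y).
rewrite -(ler_sqr (sqrt_dnorm_ge0 dot _) xy0) sqrrD !sqrtCK addrAC dnormD lerD2l.
apply: le_trans (add_conjC_le _) _; rewrite -[leRHS]mulr_natl ler_wpM2l//.
rewrite -(ler_sqr (normr_ge0 _)) ?nnegrE ?mulr_ge0 ?sqrt_dnorm_ge0//.
by rewrite exprMn !sqrtCK dot_CauchySchwarz.
Qed.

Lemma dot_normZ a (x : U) :
  sqrtC (dot (a *: x) (a *: x)) = `|a| * sqrtC (dot x x).
Proof.
by rewrite dnormZ sqrtCM ?qualifE/= ?dnorm_ge0 ?exprn_ge0// sqrCK.
Qed.

End DotNorm.

(** * Monotone convergence and infima in the complex numbers *)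

Section ComplexLimits.
Context (R : realType).

(** Nonnegative complex numbers are real, so the supremum of the real parts is the
limit. *)
Lemma nondecreasing_bounded_cvgC (u : nat -> R[i]^o) (M : R[i]) :
  (forall n, 0 <= u n) -> nondecreasing_seq u -> (forall n, u n <= M) ->
  exists l : R[i]^o, [/\ u @ \oo --> l, forall n, u n <= l
    & forall N : R[i], (forall n, u n <= N) -> l <= N].
Proof.
move=> u0 undec uM.
have ndRe : nondecreasing_seq (fun n => complex.Re (u n)).
  by move=> m n mn; have := undec m n mn; rewrite lecE => /andP[].
have Reu : cvgn (fun n => complex.Re (u n)).
  apply: nondecreasing_is_cvgn => //.
  exists (complex.Re M) => _ [n _ <-]; by have := uM n; rewrite lecE => /andP[].
set l := limn (fun n => complex.Re (u n)).
exists ((l%:C)%C : R[i]^o); split; last 2 first.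
- move=> n; rewrite -(RRe_real (ger0_real (u0 n))) lecR.
  exact: nondecreasing_cvgn_le ndRe Reu n.
- move=> N uN; have N0 : 0 <= N := le_trans (u0 0%N) (uN 0%N).
  rewrite -(RRe_real (ger0_real N0)) lecR; apply: limr_le => //.
  by near=> n; have := uN n; rewrite lecE => /andP[].
apply/cvgrPdist_lt => e e0.
have e0' := e0; rewrite ltcE /= in e0'; case/andP: e0' => /eqP Ime Ree.
move/cvgrPdist_lt : Reu => /(_ _ Ree); apply: filterS => n.
rewrite -(RRe_real (ger0_real (u0 n))) -rmorphB /= normc_def /=.
rewrite expr0n addr0 sqrtr_sqr -(RRe_real (ger0_real (ltW e0))).
by rewrite ltcR.
Unshelve. all: by end_near.
Qed.

Lemma complex_natSinv_lt (e : R[i]) : 0 < e ->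
  exists N, forall n, (N <= n)%N -> n.+1%:R^-1 < e.
Proof.
move=> e0; have eE : e = (complex.Re e)%:C%C by rewrite RRe_real// ger0_real// ltW.
have e0' : 0 < complex.Re e by move: e0; rewrite ltcE /= => /andP[].
have [N _ Ne] := near_infty_natSinv_lt (PosNum e0').
exists N => n /Ne /=; rewrite eE -ltcR fmorphV /=; congr (_^-1 < _).
by rewrite rmorph_nat.
Qed.

(** A real lower bound forces all the values to be real. *)
Lemma complex_inf (T : Type) (phi : T -> R[i]) (t0 : T) (M : R[i]) :
  M \is Num.real -> (forall t, M <= phi t) -> exists d : R[i],
  (forall t, d <= phi t) /\ (forall e, 0 < e -> exists t, phi t < d + e).
Proof.
move=> Mreal Mphi.
have phiE t : phi t = (complex.Re (phi t))%:C%C.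
  by rewrite RRe_real// (ger_real (Mphi t)).
pose A := [set complex.Re (phi t) | t in [set: T]].
have A0 : has_inf A.
  split; first by exists (complex.Re (phi t0)), t0.
  by exists (complex.Re M) => _ [t _ <-]; have := Mphi t; rewrite lecE => /andP[].
exists (inf A)%:C%C; split=> [t|e e0].
  by rewrite phiE lecR; apply: ge_inf; [case: A0|exists t].
have eE : e = (complex.Re e)%:C%C by rewrite RRe_real// ger0_real// ltW.
have e0' : 0 < complex.Re e by move: e0; rewrite ltcE /= => /andP[].
have [_ [t _ <-] te] := inf_adherent e0' A0.
by exists t; rewrite phiE eE -rmorphD ltcR.
Qed.
End ComplexLimits.

(** * The Hilbert space of square-summable sequences *)

Section L2.
Context (R : realType) (H : hilbertType R).

Definition l2_pred : {pred nat -> H} :=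
  [pred f : nat -> H | `[< exists M : R[i], forall n, \sum_(i < n) `|f i| ^+ 2 <= M >]].

Lemma sqr_normD_le (V : normedModType R[i]) (x y : V) :
  `|x + y| ^+ 2 <= 2 * (`|x| ^+ 2 + `|y| ^+ 2).
Proof.
apply: (@le_trans _ _ ((`|x| + `|y|) ^+ 2)).
  by rewrite ler_sqr ?nnegrE ?addr_ge0// ler_normD.
rewrite -subr_ge0.
have -> : 2 * (`|x| ^+ 2 + `|y| ^+ 2) - (`|x| + `|y|) ^+ 2 = (`|x| - `|y|) ^+ 2.
  by ring.
by rewrite -realEsqr rpredB// ger0_real.
Qed.

Lemma l2_submod_closed : submod_closed l2_pred.
Proof.
split=> [|a u v /asboolP[M uM] /asboolP[N vN]]; apply/asboolP.
  by exists 0 => n; rewrite big1// => i _; rewrite normr0 expr0n.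
exists (2 * (`|a| ^+ 2 * M + N)) => n.
apply: (@le_trans _ _ (2 * (`|a| ^+ 2 * \sum_(i < n) `|u i| ^+ 2
    + \sum_(i < n) `|v i| ^+ 2))).
  rewrite mulr_sumr -big_split mulr_sumr; apply: ler_sum => i _ /=.
  by rewrite -exprMn -normrZ; exact: sqr_normD_le.
by rewrite ler_wpM2l// lerD// ler_wpM2l// exprn_ge0.
Qed.

HB.instance Definition _ :=
  GRing.isSubmodClosed.Build R[i] (nat -> H) l2_pred l2_submod_closed.

Record l2 := L2 { l2_val :> nat -> H ; _ : l2_val \in l2_pred }.

HB.instance Definition _ := [isSub for l2_val].
HB.instance Definition _ := [Choice of l2 by <:].
HB.instance Definition _ := [SubChoice_isSubLmodule of l2 by <:].

Lemma l2D (x y : l2) i : (x + y) i = x i + y i. Proof. by []. Qed.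
Lemma l2Z a (x : l2) i : (a *: x) i = a *: x i. Proof. by []. Qed.

Lemma l2P (x y : l2) : (forall i, x i = y i) -> x = y.
Proof. by move=> xy; apply/val_inj/funext. Qed.

Definition l2_psum (x y : nat -> H) (n : nat) : R[i]^o :=
  \sum_(i < n) hdot (x i) (y i).

Lemma l2_psumE (x : nat -> H) n : l2_psum x x n = \sum_(i < n) `|x i| ^+ 2.
Proof. by apply: eq_bigr => i _; rewrite sqr_normr_hdot. Qed.

Lemma l2_psum_diag_cvg (x : l2) : exists l : R[i]^o,
  [/\ l2_psum x x @ \oo --> l, forall n, l2_psum x x n <= l
    & forall N : R[i], (forall n, l2_psum x x n <= N) -> l <= N].
Proof.
case: x => x xP; have /asboolP[M xM] := xP.
apply: (@nondecreasing_bounded_cvgC R (l2_psum x x) M).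
- by move=> n; rewrite l2_psumE sumr_ge0.
- by apply/nondecreasing_seqP => n; rewrite !l2_psumE big_ord_recr lerDl.
- by move=> n; rewrite l2_psumE.
Qed.

(** Polarization reduces the convergence of the inner product of two sequences to
that of the sums of squares, where convergence is monotone. *)
Lemma polarization (U : hilbertType R) (x y : U) : hdot x y =
  4^-1 * (hdot (x + y) (x + y) - hdot (x - y) (x - y)
    + 'i * (hdot (x + 'i *: y) (x + 'i *: y) - hdot (x - 'i *: y) (x - 'i *: y))).
Proof.
rewrite !dnormB !dnormD !dotZr !rmorphM /= !dot_conjC !dotZl !conjCi.
rewrite rmorphN /= conjCi opprK.
set a := hdot x x; set b := hdot y y; set c := hdot x y; set d := hdot y x.
have -> : a + b + (c + d) - (a + b - (c + d))
    + 'i * (a + - 'i * ('i * b) + (- 'i * c + 'i * d)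
            - (a + - 'i * ('i * b) - (- 'i * c + 'i * d)))
    = 2 * (c + d) + 2 * (d - c) * ('i * 'i) by ring.
by rewrite -expr2 sqrCi; field.
Qed.

Lemma l2_psum_is_cvg (x y : l2) : cvgn (l2_psum x y).
Proof.
have -> : l2_psum x y = fun n => 4^-1 *: (l2_psum (x + y : l2) (x + y : l2) n -
   l2_psum (x - y : l2) (x - y : l2) n +
   'i *: (l2_psum (x + 'i *: y : l2) (x + 'i *: y : l2) n -
   l2_psum (x - 'i *: y : l2) (x - 'i *: y : l2) n)).
  apply/funext => n; rewrite /l2_psum -!sumrB scaler_sumr -big_split /= scaler_sumr.
  by apply: eq_bigr => i _; exact: polarization.
have cvgd (z : l2) : cvgn (l2_psum z z).
  by have [l [zl _ _]] := l2_psum_diag_cvg z; apply/cvg_ex; exists l.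
apply: is_cvgZr; apply: is_cvgD; first exact: is_cvgB.
by apply: is_cvgZr; exact: is_cvgB.
Qed.

Definition l2_dot (x y : l2) : R[i] := limn (l2_psum x y).

Lemma l2_dot_cvg (x y : l2) : l2_psum x y @ \oo --> (l2_dot x y : R[i]^o).
Proof. exact: l2_psum_is_cvg. Qed.

Lemma l2_dot_lim (x y : l2) (l : R[i]^o) :
  l2_psum x y @ \oo --> l -> l2_dot x y = l.
Proof. by move=> /cvg_lim; apply. Qed.

Lemma l2_sum_le (x : l2) n : \sum_(i < n) `|x i| ^+ 2 <= l2_dot x x.
Proof.
have [l [xl xle _]] := l2_psum_diag_cvg x.
by rewrite (l2_dot_lim xl) -l2_psumE.
Qed.

Lemma l2_dot_le (x : l2) (M : R[i]) :
  (forall n, \sum_(i < n) `|x i| ^+ 2 <= M) -> l2_dot x x <= M.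
Proof.
have [l [xl _ lel]] := l2_psum_diag_cvg x.
by move=> xM; rewrite (l2_dot_lim xl); apply: lel => n; rewrite l2_psumE.
Qed.

Let l2_dot_bilinear : bilinear_for *%R (conjC \; *%R) l2_dot.
Proof.
have dotl a (x y z : l2) : l2_dot (a *: x + y) z = a * l2_dot x z + l2_dot y z.
  apply: l2_dot_lim.
  have -> : l2_psum (a *: x + y : l2) z = fun n =>
      a *: l2_psum x z n + l2_psum y z n.
    apply/funext => n; rewrite scaler_sumr -big_split.
    by apply: eq_bigr => i _; rewrite linearDl linearZl_LR.
  by apply: cvgD; [apply: cvgZr|]; exact: l2_dot_cvg.
have dotr a (x y z : l2) : l2_dot z (a *: x + y) = a^* * l2_dot z x + l2_dot z y.
  apply: l2_dot_lim.
  have -> : l2_psum z (a *: x + y : l2) = fun n =>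
      a^* *: l2_psum z x n + l2_psum z y n.
    apply/funext => n; rewrite scaler_sumr -big_split.
    by apply: eq_bigr => i _; rewrite linearDr linearZr_LR.
  by apply: cvgD; [apply: cvgZr|]; exact: l2_dot_cvg.
by split=> [u'|u] a x y; [exact: dotl|exact: dotr].
Qed.

HB.instance Definition _ := bilinear_isBilinear.Build R[i] l2 l2 R[i]
  *%R (conjC \; *%R) l2_dot l2_dot_bilinear.

Let l2_dot_herm (x y : l2) : l2_dot x y = (-1) ^+ false * conjC (l2_dot y x).
Proof.
rewrite expr0 mul1r; apply: l2_dot_lim.
apply/cvgrPdist_lt => e e0.
have /cvgrPdist_lt/(_ e e0) := @l2_dot_cvg y x; apply: filterS => n.
have -> : l2_psum x y n = (l2_psum y x n)^*.
  rewrite /l2_psum rmorph_sum; apply: eq_bigr => i _ /=.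
  by rewrite dot_conjC.
by rewrite -[X in _ -> X < _]norm_conjC rmorphB /= !conjCK.
Qed.

HB.instance Definition _ := isHermitianSesquilinear.Build R[i] l2 false
  conjC l2_dot l2_dot_herm.

Let l2_dot_gt0 (x : l2) : x != 0 -> 0 < l2_dot x x.
Proof.
move=> x0; have [i xi0] : exists i, x i != 0.
  apply/not_existsP => xi; move/eqP: x0; apply; apply: l2P => i.
  by apply/eqP; have /negP := xi i; rewrite negbK.
apply: lt_le_trans (l2_sum_le x i.+1); rewrite big_ord_recr/=.
by rewrite ltr_wpDl ?sumr_ge0// exprn_gt0// normr_gt0.
Qed.

HB.instance Definition _ := isDotProduct.Build R[i] l2 l2_dot l2_dot_gt0.

Let norm (x : l2) : R[i] := sqrtC (l2_dot x x).

Let ler_norm x y : norm (x + y) <= norm x + norm y.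
Proof. exact: dot_norm_triangle. Qed.

Let norm_Z l x : norm (l *: x) = `|l| * norm x.
Proof. exact: dot_normZ. Qed.

Let norm_0 x : norm x = 0 -> x = 0.
Proof. by move=> /eqP; rewrite sqrt_dnorm_eq0 => /eqP. Qed.

HB.instance Definition _ := Lmodule_isNormed.Build R[i] l2 ler_norm norm_Z norm_0.

Lemma l2_sqr_normr (x : l2) : `|x| ^+ 2 = l2_dot x x.
Proof. exact: sqrtCK. Qed.

Lemma l2_coord_le (x : l2) i : `|x i| <= `|x|.
Proof.
rewrite -ler_sqr ?nnegrE// l2_sqr_normr; apply: le_trans (l2_sum_le x i.+1).
by rewrite big_ord_recr/= lerDr sumr_ge0.
Qed.

(** The limit is taken coordinatewise; a small Cauchy set stays close to it because,
for each [n], some member of the set is as near to the limit as one likes in the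
first [n] coordinates. *)
Lemma l2_cauchy_cvg (F : set_system l2) : ProperFilter F -> cauchy F -> cvg F.
Proof.
move=> PF /cauchy_ballP Fc.
have Fcoord i : cvg ((fun x : l2 => x i) @ F).
  apply: cauchy_cvg; apply/cauchy_ballP => e e0; have := Fc e e0.
  case=> -[A B] /= [FA FB] AB.
  exists ((fun x : l2 => x i) @` A, (fun x : l2 => x i) @` B) => /=.
    by split; [apply: filterS FA|apply: filterS FB] => u uA; exists u.
  move=> [_ _] /= [[u Au <-] [v Bv <-]].
  have := AB (u, v) (conj Au Bv); rewrite -!ball_normE /=.
  by apply: le_lt_trans; exact: (l2_coord_le (u - v) i).
pose l i := lim ((fun x : l2 => x i) @ F).
have Fcoordl (n : nat) (d : R[i]) : 0 < d ->
    \forall y \near F, \sum_(i < n) `|l i - (y : l2) i| ^+ 2 <= d.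
  elim: n d => [|n IHn] d d0.
    by apply: nearW => y; rewrite big_ord0 ltW.
  have d2 : 0 < d / 2 by rewrite divr_gt0.
  have sd2 : 0 < sqrtC (d / 2) by rewrite sqrtC_gt0.
  have /cvgrPdist_lt/(_ _ sd2) Fn := Fcoord n.
  apply: filterS2 (IHn _ d2) Fn => y yn ln; rewrite big_ord_recr/= [leRHS]splitr.
  by rewrite lerD// -[leRHS]sqrtCK ler_sqr ?nnegrE// ltW.
(* The factor 2 pays for using |u + v|^2 <= 2 (|u|^2 + |v|^2) in place of
   Minkowski's inequality. *)
have Fl e : 0 < e -> exists2 A, F A & forall x, A x ->
    forall n, \sum_(i < n) `|l i - x i| ^+ 2 <= (2 * e) ^+ 2.
  move=> e0; have [[A B] /= [FA FB] AB] := Fc e e0.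
  exists A => // x Ax n; have e20 : 0 < e ^+ 2 by rewrite exprn_gt0.
  have [y [yB ly]] := filter_ex (filterI FB (Fcoordl n _ e20)).
  apply: (@le_trans _ _ (\sum_(i < n) 2 * (`|l i - y i| ^+ 2 + `|y i - x i| ^+ 2))).
    apply: ler_sum => i _; rewrite -(subrKA (y i)); exact: sqr_normD_le.
  rewrite -mulr_sumr big_split /= exprMn expr2 -mulrA ler_wpM2l// mulr_natl lerD//.
  apply: (le_trans (l2_sum_le (y - x) n)).
  rewrite -l2_sqr_normr ler_sqr ?nnegrE ?(ltW e0)// ltW//.
  by have := AB (x, y) (conj Ax yB); rewrite -ball_normE /= distrC.
have ll2 : l \in l2_pred.
  have [A FA Al] := Fl 1 ltr01; have [x Ax] := filter_ex FA.
  have -> : l = (l - x) + x by rewrite subrK.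
  apply: rpredD; [apply/asboolP|exact: valP x].
  by exists ((2 * 1) ^+ 2) => n; exact: Al.
apply/cvg_ex; exists (L2 ll2); apply/cvgrPdist_le => e e0.
have e2 : 0 < e / 2 by rewrite divr_gt0.
have [A FA Al] := Fl _ e2; apply: filterS FA => x Ax.
rewrite -ler_sqr ?nnegrE ?(ltW e0)// l2_sqr_normr.
by apply: l2_dot_le => n; have := Al x Ax n; rewrite mulrCA divff// mulr1.
Qed.

HB.instance Definition _ := Uniform_isComplete.Build l2 l2_cauchy_cvg.

HB.instance Definition _ := CompleteNormedModule_isHilbert.Build R l2
  l2_sqr_normr.

End L2.

(** * A variational form of the Riesz representation theorem *)

Section Operators.
Context (R : realType).

Lemma bounded_linear_operator (U V : normedModType R[i]) (f : U -> V) (M : R[i]) :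
  linear f -> (forall x, `|f x| <= M * `|x|) ->
  exists g : boundedOperator U V, g =1 f.
Proof.
move=> lf fM; pose Lf := GRing.isLinear.Build R[i] U V *:%R f lf.
pose lin : {linear U -> V} := HB.pack f Lf.
pose Bf := isBoundedOperator.Build R U V lin (ex_intro _ M fM).
pose g : boundedOperator U V := HB.pack f Lf Bf.
by exists g.
Qed.

Definition in_range_closure (F : lmodType R[i]) (E : hilbertType R) (a : F -> E) (z : E) :=
  forall e : R[i], 0 < e -> exists h, `|a h - z| < e.

(** Letting [a h] tend to [z] bounds [|z|^2] by [M |z|]. For [M = 0], applied to a
difference, this shows that a vector in the closure of the range of [a] is
determined by its inner products with that range. *)
Lemma in_range_closure_norm_le (F : lmodType R[i]) (E : hilbertType R)
    (a : {linear F -> E}) (z : E) (M : R[i]) : 0 <= M ->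
  in_range_closure a z -> (forall h, `|hdot (a h) z| <= M * `|a h|) -> `|z| <= M.
Proof.
move=> M0 az zM; have [->|z0] := eqVneq z 0; first by rewrite normr0.
have nz : 0 < `|z| by rewrite normr_gt0.
rewrite -(ler_pM2r nz); apply/ler_addgt0Pr => e e0.
have zM1 : 0 < `|z| + M by rewrite ltr_wpDr.
have [h ah] := az _ (divr_gt0 e0 zM1).
rewrite -expr2 sqr_normr_hdot -[X in X <= _]ger0_norm ?dnorm_ge0//.
have {1}-> : z = a h - (a h - z) by rewrite opprB addrC subrK.
rewrite linearBl; apply: le_trans (ler_normB _ _) _.
have aah : `|a h| <= `|z| + `|a h - z|.
  by rewrite -{1}(subrK z (a h)) addrC ler_normD.
apply: (@le_trans _ _ (M * (`|z| + `|a h - z|) + `|a h - z| * `|z|)).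
  by rewrite lerD ?hdot_CauchySchwarz// (le_trans (zM h))// ler_wpM2l.
have -> : M * (`|z| + `|a h - z|) + `|a h - z| * `|z| =
   M * `|z| + `|a h - z| * (`|z| + M) by ring.
by rewrite lerD2l -ler_pdivlMr// ltW.
Qed.

Lemma in_range_closure_linear (F : lmodType R[i]) (E : hilbertType R)
    (a : {linear F -> E}) c y z :
  in_range_closure a y -> in_range_closure a z -> in_range_closure a (c *: y + z).
Proof.
move=> ay az e e0; have c1 : 0 < `|c| + 1 by rewrite ltr_wpDl.
have e2 : 0 < e / 2 by rewrite divr_gt0.
have [h ah] := ay _ (divr_gt0 e2 c1); have [k ak] := az _ e2.
exists (c *: h + k); rewrite linearP.
have -> : c *: a h + a k - (c *: y + z) = c *: (a h - y) + (a k - z).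
  by rewrite scalerBr opprD addrACA.
rewrite (le_lt_trans (ler_normD _ _))// [ltRHS]splitr ler_ltD// normrZ.
apply: (@le_trans _ _ ((`|c| + 1) * `|a h - y|)).
  by rewrite ler_wpM2r// lerDl.
by rewrite mulrC -ler_pdivlMr// ltW.
Qed.

Lemma in_range_closureN (F : lmodType R[i]) (E : hilbertType R) (a : {linear F -> E}) z :
  in_range_closure a z -> in_range_closure a (- z).
Proof.
by move=> az e e0; have [h ah] := az _ e0; exists (- h); rewrite linearN -opprD normrN.
Qed.

Section Riesz.
Context (F : lmodType R[i]) (E : hilbertType R) (a : {linear F -> E}).
Context (f : F -> R[i]) (flin : scalar f) (M : R[i]) (M0 : 0 <= M)
  (fM : forall h, `|f h| <= M * `|a h|).

(* The functional to minimize: |a h - z|^2 = phi h + |z|^2 for the vector z that is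
   sought. *)
Let phi (h : F) : R[i] := hdot (a h) (a h) - (f h + (f h)^*).

Let phi_ge h : - M ^+ 2 <= phi h.
Proof.
rewrite /phi -sqr_normr_hdot lerBrDr.
apply: (@le_trans _ _ (- M ^+ 2 + 2 * (M * `|a h|))).
  by rewrite lerD2l (le_trans (add_conjC_le _))// ler_wpM2l.
rewrite -subr_ge0.
have -> : `|a h| ^+ 2 - (- M ^+ 2 + 2 * (M * `|a h|)) = (`|a h| - M) ^+ 2 by ring.
by rewrite -realEsqr rpredB// ger0_real.
Qed.

Let fD u v : f (u + v) = f u + f v.
Proof. by rewrite -[u]scale1r flin mul1r scale1r. Qed.

Let f0 : f 0 = 0.
Proof. by apply/eqP; rewrite -(inj_eq (addrI (f 0))) addr0 -fD addr0. Qed.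

Let fZ c u : f (c *: u) = c * f u.
Proof. by rewrite -[c *: u]addr0 flin f0 addr0. Qed.

(* The parallelogram identity makes minimizing sequences Cauchy. *)
Let phi_parallelogram h k :
  hdot (a h - a k) (a h - a k) = 2 * phi h + 2 * phi k - 4 * phi (2^-1 *: (h + k)).
Proof.
have aE : a (2^-1 *: (h + k)) = 2^-1 *: (a h + a k) by rewrite linearZ linearD.
rewrite /phi aE dotZl dotZr fZ fD.
rewrite dnormB dnormD !rmorphM /= !rmorphD fmorphV /= conjC_nat.
by field.
Qed.

Let phi_shift h k t : phi (h + t *: k) = phi h
  + t * (hdot (a k) (a h) - f k) + (t * (hdot (a k) (a h) - f k))^*
  + `|t| ^+ 2 * hdot (a k) (a k).
Proof.
have aE : a (h + t *: k) = a h + t *: a k by rewrite linearD linearZ.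
rewrite /phi aE dnormD dnormZ fD fZ dotZr.
rewrite !rmorphM /= !rmorphD !rmorphM rmorphN /= conjCK !dot_conjC.
by ring.
Qed.

(** The limit [z] of [a h_n], for a minimizing sequence [h_n] of [phi], represents
[f] on the range of [a], as the first variation of [phi] vanishes in the limit.
With the identity for [a] this is the Riesz theorem; a general [a] places the
representing vector in the closure of a prescribed range. *)
Lemma riesz_closure :
  exists z, (forall h, f h = hdot (a h) z) /\ in_range_closure a z.
Proof.
have Mreal : - M ^+ 2 \is Num.real by rewrite rpredN rpredX// ger0_real.
have [d [dphi phid]] := complex_inf 0 Mreal phi_ge.
have ngt0 n : 0 < n.+1%:R^-1 :> R[i] by rewrite invr_gt0.
have [h hd] := choice (fun n => phid n.+1%:R^-1 (ngt0 n)).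
have hCauchy (e : R[i]) : 0 < e -> exists N : nat, forall n m, (N <= n)%N -> (N <= m)%N ->
   `|a (h n) - a (h m)| < e.
  move=> e0; have e4 : 0 < e ^+ 2 / 4 by rewrite divr_gt0// exprn_gt0.
  have [N Ne] := complex_natSinv_lt e4; exists N => n m Nn Nm.
  rewrite -ltr_sqr ?nnegrE ?(ltW e0)// sqr_normr_hdot phi_parallelogram.
  have ltd k : (N <= k)%N -> 2 * phi (h k) < 2 * (d + e ^+ 2 / 4).
    move=> Nk; rewrite ltr_pM2l// (lt_trans (hd k))// ltrD2l; exact: Ne.
  have -> : e ^+ 2 = 2 * (d + e ^+ 2 / 4) + 2 * (d + e ^+ 2 / 4) - 4 * d by field.
  by rewrite ltr_leB ?ltrD ?ltd// ler_wpM2l.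
have /cvg_ex[z hz] : cvgn (fun n => a (h n)).
  apply: cauchy_cvg; apply/cauchy_ballP => e e0.
  have [N Ne] := hCauchy e e0; pose A := (fun n => a (h n)) @` [set n | (N <= n)%N].
  exists (A, A) => /=.
    by split; exists N => // n Nn; exists n.
  by move=> [_ _] /= [[n Nn <-] [m Nm <-]]; rewrite -ball_normE; exact: Ne.
have az : in_range_closure a z.
  move=> e e0; move/cvgrPdist_lt: hz => /(_ e e0) [N _ Ne].
  by exists (h N); rewrite distrC; apply: Ne => /=.
exists z; split=> // k; apply/eqP; rewrite eq_sym -subr_eq0 -normr_le0.
apply/ler_addgt0Pr => e e0; rewrite add0r.
set A := hdot (a k) (a k); have A0 : 0 <= A by exact: dnorm_ge0.
have A1 : 0 < A + 1 by rewrite ltr_wpDl.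
pose w n := hdot (a k) (a (h n)) - f k.
have wn n : `|w n| ^+ 2 <= (A + 1) * n.+1%:R^-1.
  (* Since s A <= 1, the quadratic term s^2 A |w n|^2 of the variation costs at most
     half of the decrease 2 s |w n|^2 brought by the linear one. *)
  pose s : R[i] := (A + 1)^-1; have s0 : 0 < s by rewrite invr_gt0.
  have sC : s^* = s by apply/CrealP/ger0_real/ltW.
  have := dphi (h n + (- (s * (w n)^*)) *: k).
  rewrite phi_shift -/(w n) -/A normrN normrM norm_conjC (ger0_norm (ltW s0)).
  rewrite mulNr -mulrA [_^* * _]mulrC -normCK rmorphN rmorphM /= sC.
  rewrite [(_ ^+ 2)^*]conj_Creal ?rpredX ?ger0_real// exprMn.
  have -> : phi (h n) - s * `|w n| ^+ 2 - s * `|w n| ^+ 2 + s ^+ 2 * `|w n| ^+ 2 * A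
      = phi (h n) - s * `|w n| ^+ 2 - s ^+ 2 * `|w n| ^+ 2.
    have -> : A = s^-1 - 1 by rewrite invrK addrK.
    by field; rewrite gt_eqF.
  move=> dn; rewrite -ler_pdivrMl// -/s -(lerD2l d) (le_trans _ (ltW (hd n)))//.
  rewrite -lerBrDr (le_trans dn)// lerBlDr lerDl.
  by rewrite mulr_ge0// exprn_ge0// ltW.
have e2 : 0 < e / 2 by rewrite divr_gt0.
have ak1 : 0 < `|a k| + 1 by rewrite ltr_wpDl.
move/cvgrPdist_lt: hz => /(_ _ (divr_gt0 e2 ak1)) [N1 _ N1e].
have [N2 N2e] := complex_natSinv_lt (divr_gt0 (exprn_gt0 2 e2) A1).
pose n := maxn N1 N2.
have -> : hdot (a k) z - f k = hdot (a k) (z - a (h n)) + w n.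
  by rewrite linearBr addrA subrK.
rewrite (le_trans (ler_normD _ _))// [leRHS]splitr lerD//; last first.
  rewrite -ler_sqr ?nnegrE ?(ltW e2)// (le_trans (wn n))// mulrC -ler_pdivlMr//.
  by rewrite ltW// N2e// leq_maxr.
rewrite (le_trans (hdot_CauchySchwarz _ _))//.
apply: (@le_trans _ _ ((`|a k| + 1) * `|z - a (h n)|)).
  by rewrite ler_wpM2r// lerDl.
by rewrite mulrC -ler_pdivlMr// ltW// N1e//= leq_maxl.
Qed.

End Riesz.
End Operators.

(** * Adjoints and contractive factorization *)

Section Adjoint.
Context (R : realType).

Lemma hdot_inj (E : hilbertType R) (y z : E) :
  (forall x, hdot x y = hdot x z) -> y = z.
Proof.
move=> yz; apply/eqP; rewrite -subr_eq0 -(dnorm_eq0 hdot) dotBr subr_eq0.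
by apply/eqP; exact: yz.
Qed.

Lemma adjoint_exists (E F : hilbertType R) (T : {linear E -> F}) (M : R[i]) :
  0 <= M -> (forall x, `|T x| <= M * `|x|) ->
  exists T' : boundedOperator F E,
    (forall x y, hdot (T x) y = hdot x (T' y)) /\ (forall y, `|T' y| <= M * `|y|).
Proof.
move=> M0 TM.
have rep (y : F) : exists z, forall x, hdot (T x) y = hdot x z.
  have flin : scalar (fun x => hdot (T x) y).
    by move=> c u v; rewrite (linearP T) dotDl dotZl.
  have fM x : `|hdot (T x) y| <= M * `|y| * `|idfun x|.
    by rewrite (le_trans (hdot_CauchySchwarz _ _))// mulrAC ler_wpM2r.
  have [z [zf _]] := riesz_closure flin (mulr_ge0 M0 (normr_ge0 y)) fM.
  by exists z.
have [T' T'E] := choice rep.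
have T'lin : linear T'.
  move=> c u v; apply: hdot_inj => x.
  by rewrite -T'E !dotDr !dotZr !T'E.
have T'M y : `|T' y| <= M * `|y|.
  have [->|y0] := eqVneq (T' y) 0; first by rewrite normr0 mulr_ge0.
  have ny : 0 < `|T' y| by rewrite normr_gt0.
  rewrite -(ler_pM2r ny) -expr2 sqr_normr_hdot -T'E.
  rewrite -[leLHS]ger0_norm; last by rewrite T'E dnorm_ge0.
  by rewrite (le_trans (hdot_CauchySchwarz _ _))// mulrAC ler_wpM2r.
have [T'' T''E] := bounded_linear_operator T'lin T'M.
by exists T''; split=> [x y|y]; rewrite T''E.
Qed.

(** This is Douglas' factorization lemma. The adjoint of [C] sends [y] to the vector
in the closure of the range of [a] that represents [h |-> <b h, y>] along [a];
uniqueness of such vectors makes it linear. *)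
Lemma contractive_factor (F : lmodType R[i]) (E E' : hilbertType R)
    (a : {linear F -> E}) (b : {linear F -> E'}) :
  (forall h, `|b h| <= `|a h|) ->
  exists C : boundedOperator E E',
    (forall h, C (a h) = b h) /\ (forall x, `|C x| <= `|x|).
Proof.
move=> ba.
have rep (y : E') : exists z, (forall h, hdot (b h) y = hdot (a h) z) /\ in_range_closure a z.
  have flin : scalar (fun x => hdot (b x) y).
    by move=> c u v; rewrite (linearP b) dotDl dotZl.
  have fM h : `|hdot (b h) y| <= `|y| * `|a h|.
    by rewrite (le_trans (hdot_CauchySchwarz _ _))// mulrC ler_wpM2l.
  by have [z zP] := riesz_closure flin (normr_ge0 y) fM; exists z.
have [Z ZP] := choice rep.
have Zlin : linear Z.
  move=> c u v; apply/eqP; rewrite -subr_eq0 -normr_le0.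
  apply: (@in_range_closure_norm_le _ F _ a) => //.
    have [_ Zu] := ZP u; have [_ Zv] := ZP v; have [_ Zuv] := ZP (c *: u + v).
    rewrite -[X in in_range_closure _ (X - _)]scale1r; apply: in_range_closure_linear => //.
    by apply: in_range_closureN; exact: in_range_closure_linear.
  move=> h; rewrite mul0r normr_le0 dotBr dotDr dotZr -!(ZP _).1.
  by rewrite dotDr dotZr subrr.
have Z1 y : `|Z y| <= 1 * `|y|.
  have [Zy aZ] := ZP y; rewrite mul1r; apply: in_range_closure_norm_le aZ _ => // h.
  rewrite -Zy (le_trans (hdot_CauchySchwarz _ _))// mulrC ler_wpM2l//.
have [Z' Z'E] := bounded_linear_operator Zlin Z1.
have Z'1 y : `|Z' y| <= 1 * `|y| by rewrite Z'E.
have [C [CE C1]] := adjoint_exists ler01 Z'1.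
exists C; split=> [h|x]; last by rewrite -[leRHS]mul1r.
apply: hdot_inj => y.
have <- : hdot (Z y) (a h) = hdot y (C (a h)) by rewrite -Z'E; exact: CE.
by rewrite -dot_conjC -(ZP y).1 dot_conjC.
Qed.

End Adjoint.

(** * Concatenation and interleaving of sequences *)

Section Coordinates.
Context (R : realType) (H : hilbertType R).
Implicit Types (h : H) (x y t u v : l2 H).

Let in_l2 (f : nat -> H) (M : R[i]) :
  (forall n, \sum_(i < n) `|f i| ^+ 2 <= M) -> f \in @l2_pred R H.
Proof. by move=> fM; apply/asboolP; exists M. Qed.

Definition cons_seq h (t : nat -> H) (i : nat) := if i is j.+1 then t j else h.

Let cons_seq_in h t : cons_seq h t \in @l2_pred R H.
Proof.
apply: (@in_l2 _ (`|h| ^+ 2 + `|t| ^+ 2)) => -[|n].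
  by rewrite big_ord0 addr_ge0// exprn_ge0.
by rewrite big_ord_recl/= lerD2l l2_sqr_normr l2_sum_le.
Qed.

(** With [lbehead], this identifies [l2 H] with the orthogonal sum of [H] and
[l2 H]. *)
Definition lcons h t : l2 H := L2 (cons_seq_in h t).

Let behead_in x : (fun i => x i.+1) \in @l2_pred R H.
Proof.
apply: (@in_l2 _ (`|x| ^+ 2)) => n; rewrite l2_sqr_normr.
apply: le_trans (l2_sum_le x n.+1).
by rewrite [leRHS]big_ord_recl/= lerDr exprn_ge0.
Qed.

Definition lbehead x : l2 H := L2 (behead_in x).

Lemma lconsK x : lcons (x 0%N) (lbehead x) = x.
Proof. by apply: l2P => -[]. Qed.

Lemma lbehead_cons h t : lbehead (lcons h t) = t.
Proof. exact: l2P. Qed.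

Lemma lbeheadP c x y : lbehead (c *: x + y) = c *: lbehead x + lbehead y.
Proof. exact: l2P. Qed.

Lemma lconsP c h t h' t' :
  lcons (c *: h + h') (c *: t + t') = c *: lcons h t + lcons h' t'.
Proof. by apply: l2P => -[]. Qed.

Lemma hdot_lcons h t h' t' :
  hdot (lcons h t) (lcons h' t') = hdot h h' + hdot t t'.
Proof.
apply: l2_dot_lim; rewrite -(cvg_shiftS (l2_psum _ _)).
have -> : (fun n => l2_psum (lcons h t) (lcons h' t') n.+1) =
    fun n => hdot h h' + l2_psum t t' n.
  by apply/funext => n; rewrite /l2_psum big_ord_recl.
apply: cvgD; [exact: cvg_cst|exact: l2_dot_cvg].
Qed.

Lemma sqr_norm_lcons h t : `|lcons h t| ^+ 2 = `|h| ^+ 2 + `|t| ^+ 2.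
Proof. by rewrite !sqr_normr_hdot hdot_lcons. Qed.

(** Interleaving shows that [l2 H] has room for the orthogonal sum of two copies of
itself. *)
Definition mix_seq (u v : nat -> H) (i : nat) := (if odd i then v else u) i./2.

Let mix_sum (u v : nat -> H) (g : H -> R[i]) n :
  \sum_(i < n.*2) g (mix_seq u v i) = \sum_(i < n) g (u i) + \sum_(i < n) g (v i).
Proof.
elim: n => [|n IHn]; first by rewrite !big_ord0 addr0.
rewrite doubleS !big_ord_recr/= IHn /mix_seq /= odd_double /= uphalf_double doubleK.
by rewrite addrACA addrA.
Qed.

Let mix_seq_in u v : mix_seq u v \in @l2_pred R H.
Proof.
apply: (@in_l2 _ (`|u| ^+ 2 + `|v| ^+ 2)) => n.
apply: (@le_trans _ _ (\sum_(i < n.*2) `|mix_seq u v i| ^+ 2)).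
  by rewrite -addnn big_split_ord/= lerDl sumr_ge0// => i _; rewrite exprn_ge0.
by rewrite (mix_sum u v (fun z => `|z| ^+ 2)) !l2_sqr_normr lerD// l2_sum_le.
Qed.

Definition lmix u v : l2 H := L2 (mix_seq_in u v).

Lemma lmixP c u v u' v' :
  lmix (c *: u + u') (c *: v + v') = c *: lmix u v + lmix u' v'.
Proof. by apply: l2P => i; rewrite l2D l2Z /= /mix_seq; case: (odd i). Qed.

Lemma sqr_norm_lmix u v : `|lmix u v| ^+ 2 = `|u| ^+ 2 + `|v| ^+ 2.
Proof.
rewrite !sqr_normr_hdot.
(* The partial sums of even length are sums over u and over v. *)
have hcvg : (fun n => l2_psum (lmix u v) (lmix u v) n.*2) @ \oo -->
    (hdot (lmix u v) (lmix u v) : R[i]^o).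
  apply: (@cvg_comp _ _ _ double (l2_psum (lmix u v) (lmix u v)) \oo \oo);
    last exact: l2_dot_cvg.
  move=> A [N _ NA]; exists N => // n /= Nn; apply: NA => /=.
  by rewrite (leq_trans Nn)// -addnn leq_addr.
have : (fun n => l2_psum (lmix u v) (lmix u v) n.*2) @ \oo -->
    (hdot u u + hdot v v : R[i]^o).
  have -> : (fun n => l2_psum (lmix u v) (lmix u v) n.*2) =
      fun n => l2_psum u u n + l2_psum v v n.
    apply/funext => n; rewrite !l2_psumE.
    exact: (mix_sum u v (fun z => `|z| ^+ 2)).
  by apply: cvgD; exact: l2_dot_cvg.
exact: cvg_unique.
Qed.

Lemma isometric_lcons (V : l2 H -> H) (W : l2 H -> l2 H) :
  (forall x, `|V x| ^+ 2 + `|W x| ^+ 2 = `|x 0%N| ^+ 2 + `|lbehead x| ^+ 2) ->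
  isometric (fun x => lcons (V x) (W x)).
Proof.
move=> VW x; apply/eqP; rewrite -(@eqrXn2 _ 2)//; apply/eqP.
by rewrite sqr_norm_lcons VW -sqr_norm_lcons lconsK.
Qed.

End Coordinates.

(** * The defect operator and the isometric lift of a contraction *)

Section Defect.
Context (R : realType) (H : hilbertType R) (T : 'B(H)).

(** [D h] is the sequence of differences [y_n - y_(n+2)] of the alternating iterates
of [T] and its adjoint. The usual defect operator is the square root of
[1 - T' T]; only the norm identity is of use, and it follows by telescoping. *)
Lemma defect_exists : (forall h, `|T h| <= `|h|) ->
  exists D : boundedOperator H (l2 H), forall h, `|D h| ^+ 2 = `|h| ^+ 2 - `|T h| ^+ 2.
Proof.
move=> T1.
have T1' h : `|T h| <= 1 * `|h| by rewrite mul1r.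
have [T' [TT' T'1]] := adjoint_exists ler01 T1'.
(* Consecutive factors are adjoint to each other, which turns the inner product of
   y_n and y_(n+2) into |y_(n+1)|^2. *)
pose S n : 'B(H) := if odd n then T' else T.
have SS n x y : hdot (S n x) y = hdot x (S n.+1 y).
  rewrite /S/=; case: (odd n) => /=; last exact: TT'.
  by rewrite -dot_conjC -[RHS]dot_conjC; congr (_^*); rewrite -[LHS]TT'.
have S1 n x : `|S n x| <= `|x|.
  by rewrite /S; case: (odd n) => //; rewrite (le_trans (T'1 _))// mul1r.
pose y h := fix y n := if n is m.+1 then S m (y m) else h.
have yP c h h' n : y (c *: h + h') n = c *: y h n + y h' n.
  elim: n => //= n ->; exact: linearP.
pose d h n := y h n - y h n.+2.
have dE h n : `|d h n| ^+ 2 =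
    (`|y h n| ^+ 2 - `|y h n.+1| ^+ 2) - (`|y h n.+1| ^+ 2 - `|y h n.+2| ^+ 2).
  rewrite !sqr_normr_hdot /d dnormB.
  have e : hdot (y h n) (y h n.+2) = hdot (y h n.+1) (y h n.+1).
    by rewrite [y h n.+2]/= -SS.
  rewrite e [_^*]dot_conjC.
  by ring.
have dsum h n : \sum_(i < n) `|d h i| ^+ 2 =
    (`|h| ^+ 2 - `|T h| ^+ 2) - (`|y h n| ^+ 2 - `|y h n.+1| ^+ 2).
  elim: n => [|n IHn]; first by rewrite big_ord0 subrr.
  by rewrite big_ord_recr/= IHn dE; ring.
have ydec h n : `|y h n.+1| ^+ 2 <= `|y h n| ^+ 2.
  by rewrite ler_sqr ?nnegrE//=.
have d_in h : d h \in @l2_pred R H.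
  apply/asboolP; exists (`|h| ^+ 2 - `|T h| ^+ 2) => n.
  by rewrite dsum gerBl subr_ge0.
pose D h : l2 H := L2 (d_in h).
have DE h : `|D h| ^+ 2 = `|h| ^+ 2 - `|T h| ^+ 2.
  rewrite sqr_normr_hdot; apply: l2_dot_lim.
  pose u n : R[i]^o := `|h| ^+ 2 - `|y h n| ^+ 2.
  have u_ndec : nondecreasing_seq u.
    by apply/nondecreasing_seqP => n; rewrite lerD2l lerN2.
  have u_ge0 n : 0 <= u n.
    by rewrite (le_trans _ (u_ndec 0%N n (leq0n n)))// /u /= subrr.
  have u_le n : u n <= `|h| ^+ 2 by rewrite gerBl exprn_ge0.
  have [l [ul _ _]] := nondecreasing_bounded_cvgC u_ge0 u_ndec u_le.
  have ul' : (fun n => u n.+1) @ \oo --> l by rewrite cvg_shiftS.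
  have -> : l2_psum (D h) (D h) =
      fun n => (`|h| ^+ 2 - `|T h| ^+ 2 : R[i]^o) - (u n.+1 - u n).
    by apply/funext => n; rewrite l2_psumE dsum /u; ring.
  rewrite -[X in _ --> X]subr0 -[X in _ --> _ - X](subrr l).
  by apply: cvgB; [exact: cvg_cst|exact: cvgB].
have Dlin : linear D.
  by move=> c h h'; apply: l2P => n; rewrite /= /d !yP scalerBr opprD addrACA.
have D1 h : `|D h| <= 1 * `|h|.
  by rewrite mul1r -ler_sqr ?nnegrE// DE gerBl exprn_ge0.
have [D' D'E] := bounded_linear_operator Dlin D1.
by exists D' => h; rewrite D'E.
Qed.

(** The formula for [V] is kept in the conclusion, and not only the fact that [V] is
an isometric lift, because the defect part must be seen to vanish when [V] is
applied where [T] is isometric. *)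
Lemma isometric_lift_exists : (forall h, `|T h| <= `|h|) ->
  exists (D : boundedOperator H (l2 H)) (V : 'B(l2 H)),
  [/\ forall h, `|D h| ^+ 2 = `|h| ^+ 2 - `|T h| ^+ 2, isometric V &
      forall x : l2 H, V x = lcons (T (x 0%N)) (lmix (D (x 0%N)) (lbehead x))].
Proof.
move=> T1; have [D DE] := defect_exists T1.
pose V (x : l2 H) := lcons (T (x 0%N)) (lmix (D (x 0%N)) (lbehead x)).
have Vlin : linear V.
  move=> c x y; rewrite /V -lconsP -lmixP; congr (lcons _ (lmix _ _)).
  - exact: linearP.
  - exact: linearP.
  - exact: l2P.
have Viso : isometric V.
  by apply: isometric_lcons => x; rewrite sqr_norm_lmix DE addrA subrKC.
have V1 x : `|V x| <= 1 * `|x| by rewrite mul1r Viso.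
have [V' V'E] := bounded_linear_operator Vlin V1.
by exists D, V'; split => // x; rewrite V'E.
Qed.
End Defect.

(** * Lifting the intertwining relation *)

Section Lifting.
Context (R : realType).

(** [P] is the adjoint of [J], the projection onto the embedded copy of [H]; being a
lift is stated through adjoints, but amounts to [P B = A P] by taking adjoints on
both sides. *)
Lemma is_lift_compression (H K : hilbertType R) (J : {linear H -> K})
    (P : K -> H) (A : 'B(H)) (B : 'B(K)) :
  (forall z h, hdot z (J h) = hdot (P z) h) ->
  (forall z, P (B z) = A (P z)) -> is_lift J A B.
Proof.
move=> PJ PB.
have [M M0 AM] := bounded_operator_pos A; have [N N0 BN] := bounded_operator_pos B.
have [A' [AA' _]] := adjoint_exists M0 AM.
have [B' [BB' _]] := adjoint_exists N0 BN.
exists A', B'; split=> [x y|x y|h]; [exact: AA'|exact: BB'|].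
by apply: hdot_inj => z; rewrite -BB' !PJ PB AA'.
Qed.

Lemma boundedB (U V : normedModType R[i]) (f g : boundedOperator U V) :
  exists k : boundedOperator U V, forall x, k x = f x - g x.
Proof.
have [M M0 fM] := bounded_operator_pos f; have [N N0 gN] := bounded_operator_pos g.
apply: (@bounded_linear_operator _ _ _ (fun x => f x - g x) (M + N)).
  by move=> c x y; rewrite (linearP f) (linearP g) scalerBr opprD addrACA.
by move=> x; rewrite (le_trans (ler_normB _ _))// mulrDl lerD.
Qed.

Lemma boundedD (U V : normedModType R[i]) (f g : boundedOperator U V) :
  exists k : boundedOperator U V, forall x, k x = f x + g x.
Proof.
have [M M0 fM] := bounded_operator_pos f; have [N N0 gN] := bounded_operator_pos g.
apply: (@bounded_linear_operator _ _ _ (fun x => f x + g x) (M + N)).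
  by move=> c x y; rewrite (linearP f) (linearP g) scalerDr addrACA.
by move=> x; rewrite (le_trans (ler_normD _ _))// mulrDl lerD.
Qed.

Lemma bounded_id (U : normedModType R[i]) : exists k : 'B(U), forall x, k x = x.
Proof.
by apply: (@bounded_linear_operator _ _ _ (fun x : U => x) 1) => // x; rewrite mul1r.
Qed.

(** [Q] acts on the embedded copy of [H] and the identity on its complement, while
[V2Q] is [W] with its compression [Q T2] replaced by [T2]: both are obtained by
adding to an operator on [K] a correction with values in the range of [J], and
then [Qbar V2Q = W]. *)
Lemma intertwined_lifts_direct_sum (H K : hilbertType R) (J : {linear H -> K})
    (P : boundedOperator K H) (T1 T2 Q : 'B(H)) (V1 V2 W : 'B(K)) :
  isometry hdot hdot J ->
  (forall z h, hdot z (J h) = hdot (P z) h) ->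
  [/\ isometric V1, isometric V2 & isometric W] ->
  (forall z, P (V1 z) = T1 (P z)) ->
  (forall z, P (V2 z) = T2 (P z)) ->
  (forall z, P (W z) = Q (T2 (P z))) ->
  (forall z, V1 (V2 z) = W (V1 z)) ->
  exists (Q' : 'B(ocompl J)) (Qbar V1 V2 V2Q : 'B(K)),
      [/\ is_direct_sum Q Q' Qbar,
          isometric_lift J T1 V1,
          isometric_lift J T2 V2,
          isometric_lift J (Q \o T2) (Qbar \o V2Q)
        & V1 \o V2 =1 Qbar \o V2Q \o V1].
Proof.
move=> Jiso JP [V1iso V2iso Wiso] PV1 PV2 PW VW.
have PJ h : P (J h) = h.
  by apply: hdot_inj => x; rewrite -dot_conjC -JP Jiso dot_conjC.
have Jbd h : `|J h| <= 1 * `|h|.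
  by rewrite mul1r -ler_sqr ?nnegrE// !sqr_normr_hdot Jiso.
have [J' J'E] := @bounded_linear_operator _ _ _ J 1 (linearP J) Jbd.
have [id' id'E] := bounded_id (ocompl J).
have [idK idKE] := bounded_id K.
have [F FE] := boundedB (Q \o P) P.
have [Qbar QbarE] := boundedD idK (J' \o F).
have [G GE] := boundedB (T2 \o P) (P \o W).
have [V2Q V2QE] := boundedD W (J' \o G).
have PD u v : P (u + v) = P u + P v by exact: linearD.
have PV2Q z : P (V2Q z) = T2 (P z).
  by rewrite V2QE PD /= J'E PJ GE /= subrKC.
have QV z : Qbar (V2Q z) = W z.
  rewrite QbarE idKE /= J'E FE /= PV2Q V2QE /= J'E GE /= PW -addrA -linearD.
  by rewrite subrKA subrr linear0 addr0.
exists id', Qbar, V1, V2, V2Q; split.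
- move=> h k.
  have Pk : P (\val k) = 0.
    apply: hdot_inj => x; rewrite linear0r -dot_conjC -JP.
    have /ocompl_predP k0 := valP k.
    by rewrite -dot_conjC k0 !conjC0.
  rewrite QbarE idKE id'E /= J'E FE /= PD PJ Pk addr0 addrAC -linearD.
  by rewrite subrKC.
- by split=> //; exact: is_lift_compression JP PV1.
- by split=> //; exact: is_lift_compression JP PV2.
- split; last by move=> z; rewrite /= QV Wiso.
  by apply: is_lift_compression JP _ => z /=; rewrite QV PW.
- by move=> z /=; rewrite QV VW.
Qed.

(** [W] being an isometric lift of [S], the vectors [W (V1 x)] and [V1 (V2 x)] agree
in norm and in their zeroth coordinate, hence their tails agree in norm; [C] is
[W] followed by a contraction that carries the former tails to the latter. *)
Lemma contractive_intertwiner (H : hilbertType R) (T1 T2 S : 'B(H)) :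
  (forall h, `|T1 h| <= `|h|) -> (forall h, `|T2 h| <= `|h|) ->
  (forall h, `|S h| <= `|h|) -> (forall h, T1 (T2 h) = S (T1 h)) ->
  exists V1 V2 C : 'B(l2 H),
  [/\ isometric V1, isometric V2, forall x, `|C x| <= `|x|,
     [/\ forall x : l2 H, (V1 x) 0%N = T1 (x 0%N),
       forall x : l2 H, (V2 x) 0%N = T2 (x 0%N) &
       forall x : l2 H, (C x) 0%N = S (x 0%N)] &
   forall x, V1 (V2 x) = C (V1 x)].
Proof.
move=> T1c T2c Sc TS.
have [D1 [V1 [_ V1iso V1E]]] := isometric_lift_exists T1c.
have [D2 [V2 [_ V2iso V2E]]] := isometric_lift_exists T2c.
have [DS [W [_ Wiso WE]]] := isometric_lift_exists Sc.
pose a x := lbehead (W (V1 x)); pose b x := lbehead (V1 (V2 x)).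
have alin : linear a by move=> c x y; rewrite /a !linearP lbeheadP.
have blin : linear b by move=> c x y; rewrite /b !linearP lbeheadP.
pose a' : {linear l2 H -> l2 H} := HB.pack a (GRing.isLinear.Build R[i] _ _ *:%R a alin).
pose b' : {linear l2 H -> l2 H} := HB.pack b (GRing.isLinear.Build R[i] _ _ *:%R b blin).
have head x : (W (V1 x)) 0%N = (V1 (V2 x)) 0%N.
  by rewrite WE !V1E /= V2E /= TS.
have ba x : `|b' x| <= `|a' x|.
  rewrite -ler_sqr ?nnegrE//= -(lerD2l (`|(V1 (V2 x)) 0%N| ^+ 2)).
  rewrite -{2}head -!sqr_norm_lcons !lconsK V1iso V2iso Wiso V1iso //.
have [C0 [C0a C01]] := contractive_factor ba.
pose C x := lcons ((W x) 0%N) (C0 (lbehead (W x))).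
have Clin : linear C.
  by move=> c x y; rewrite /C linearP -lconsP lbeheadP linearP.
have C1 x : `|C x| <= `|x|.
  rewrite -(Wiso x) -ler_sqr ?nnegrE// -[W x in leRHS]lconsK !sqr_norm_lcons lerD2l.
  by rewrite ler_sqr ?nnegrE.
have C1' x : `|C x| <= 1 * `|x| by rewrite mul1r.
have [C' C'E] := bounded_linear_operator Clin C1'.
exists V1, V2, C'; split => //.
- by move=> x; rewrite C'E.
- by split=> x; rewrite ?C'E /C /= ?V1E ?V2E ?WE.
- move=> x; rewrite C'E /C head.
  have -> : C0 (lbehead (W (V1 x))) = lbehead (V1 (V2 x)) by exact: C0a.
  by rewrite lconsK.
Qed.

End Lifting.

Theorem theorem5p4 (R : realType) (H : hilbertType R) (T1 T2 Q : 'B(H))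
    (T1_contraction : contractive_op T1) (T2_contraction : contractive_op T2)
    (QT2_contraction : contractive_op (Q \o T2))
    (T1T2 : T1 \o T2 =1 Q \o T2 \o T1) :
  exists (K : hilbertType R) (J : {linear H -> K}),
    isometry hdot hdot J /\
    exists (Q' : 'B(ocompl J)) (Qbar V1 V2 V2Q : 'B(K)),
      [/\ is_direct_sum Q Q' Qbar,
          isometric_lift J T1 V1,
          isometric_lift J T2 V2,
          isometric_lift J (Q \o T2) (Qbar \o V2Q)
        & V1 \o V2 =1 Qbar \o V2Q \o V1].
Proof.
have /contractive_opP T1c := T1_contraction.
have /contractive_opP T2c := T2_contraction.
have /contractive_opP Sc := QT2_contraction.
have [V1 [V2 [C [V1iso V2iso Cc [V1E V2E CE] VC]]]] :=
  contractive_intertwiner T1c T2c Sc T1T2.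
have [D [W [DE Wiso WE]]] := isometric_lift_exists Cc.
pose K : hilbertType R := l2 (l2 H).
pose J h : K := lcons (lcons h 0) 0.
have Jlin : linear J.
  by move=> c h h'; rewrite /J -!lconsP !scaler0 !addr0.
pose J' : {linear H -> K} := HB.pack J (GRing.isLinear.Build R[i] H K *:%R J Jlin).
have hdotJ (z : K) h : hdot z (J h) = hdot ((z 0%N) 0%N) h.
  by rewrite -{1}(lconsK z) hdot_lcons -{1}(lconsK (z 0%N)) hdot_lcons !linear0r !addr0.
have Plin : linear (fun z : K => (z 0%N) 0%N) by [].
have P1 z : `|(z : K) 0%N 0%N| <= 1 * `|z|.
  by rewrite mul1r (le_trans (l2_coord_le _ _))// l2_coord_le.
have [P PE] := bounded_linear_operator Plin P1.
pose V1' (z : K) : K := lcons (V1 (z 0%N)) (lbehead z).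
pose V2' (z : K) : K := lcons (V2 (z 0%N)) (lmix 0 (lbehead z)).
have V1'lin : linear V1'.
  by move=> c x y; rewrite /V1' -lconsP lbeheadP; congr lcons; exact: linearP.
have V2'lin : linear V2'.
  move=> c x y; rewrite /V2' -lconsP -lmixP lbeheadP scaler0 addr0.
  by congr lcons; exact: linearP.
have V1'iso : isometric V1' by apply: isometric_lcons => z; rewrite V1iso.
have V2'iso : isometric V2'.
  apply: isometric_lcons => z.
  by rewrite sqr_norm_lmix V2iso normr0 expr0n add0r.
have V1'1 z : `|V1' z| <= 1 * `|z| by rewrite mul1r V1'iso.
have V2'1 z : `|V2' z| <= 1 * `|z| by rewrite mul1r V2'iso.
have [U1 U1E] := bounded_linear_operator V1'lin V1'1.
have [U2 U2E] := bounded_linear_operator V2'lin V2'1.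
exists K, J'; split.
  by move=> h h'; exact: (hdotJ (J h) h').
apply: (@intertwined_lifts_direct_sum _ _ _ J' P T1 T2 Q U1 U2 W).
- by move=> h h'; exact: (hdotJ (J h) h').
- by move=> z h; rewrite PE; exact: hdotJ.
- by split=> // z; rewrite ?U1E ?U2E.
- by move=> z; rewrite !PE U1E /= V1E.
- by move=> z; rewrite !PE U2E /= V2E.
- by move=> z; rewrite !PE WE /= CE.
- move=> z; rewrite !U1E U2E WE /V1' /V2' /= VC !lbehead_cons.
  (* C is isometric on the range of V1, so its defect vanishes there. *)
  suff -> : D (V1 (z 0%N)) = 0 by [].
  apply/eqP; rewrite -normr_eq0 -sqrf_eq0 DE -VC !V1iso V2iso.
  by rewrite subrr.
Qed.
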